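(* Let $M$ be a $G$-graded $R$-module. Then for each $Q\in\mathcal{PS}_G(M)$, the closed set $\nu_G(Q)$ is an irreducible closed subset of $\mathcal{PS}_G(M)$. In particular, if $\{0\}\in\mathcal{PS}_G(M)$, then $\mathcal{PS}_G(M)$ is irreducible.
   Context: $G$ is a multiplicative group, $R=\bigoplus_{g\in G}R_g$ is a commutative $G$-graded ring with identity ($R_gR_h\subseteq R_{gh}$), and $M=\bigoplus_{g\in G}M_g$ is a $G$-graded $R$-module ($R_gM_h\subseteq M_{gh}$). $h(R)=\bigcup_g R_g$ and $h(M)=\bigcup_g M_g$ are the sets of homogeneous elements. An ideal $I$ is graded if $I=\bigoplus_g(I\cap R_g)$; a submodule $N$ is graded if $N=\bigoplus_g(N\cap M_g)$. For a graded submodule $N$, $(N:_R M)=\{r\in R: rM\subseteq N\}$, a graded ideal of $R$. For a graded ideal $I$, the graded radical $Gr(I)$ is the set of all $a=\sum_g a_g\in R$ such that for each $g$ there is $n_g>0$ with $a_g^{n_g}\in I$. A proper graded submodule $P$ of $M$ is graded prime if for $r\in h(R)$, $m\in h(M)$, $rm\in P$ implies $m\in P$ or $r\in(P:_R M)$. $Spec_G(M)$ is the set of graded prime submodules of $M$. A proper graded submodule $Q$ is graded primary if for $r\in h(R)$, $m\in h(M)$, $rm\in Q$ implies $m\in Q$ or $r\in Gr((Q:_R M))$. For a graded submodule $N$, $Gr_M(N)$ is the intersection of all graded prime submodules of $M$ containing $N$, with $Gr_M(N)=M$ if there are none. The graded primary spectrum $\mathcal{PS}_G(M)$ is the set of all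 graded primary submodules $Q$ of $M$ with $(Gr_M(Q):_R M)=Gr((Q:_R M))$. For a graded submodule $N$ of $M$, $\nu_G(N)=\{Q\in\mathcal{PS}_G(M): (N:_R M)\subseteq(Gr_M(Q):_R M)\}$. $\mathcal{PS}_G(M)$ carries the Zariski topology, whose closed sets are exactly the sets $\nu_G(N)$, $N$ a graded submodule of $M$. A topological space is irreducible if any two non-empty open subsets intersect; a subset is irreducible if it is so in the induced topology. Standing assumption: $Spec_G(M)$ and $\mathcal{PS}_G(M)$ are non-empty. *)

(* Defs.v *)
From HB Require Import structures.
From mathcomp Require Import all_boot all_algebra.
From mathcomp Require Import all_classical topology.

Set Implicit Arguments.
Unset Strict Implicit.
Unset Printing Implicit Defensive.

Import GRing.Theory.
Local Open Scope classical_set_scope.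
Local Open Scope ring_scope.

Section DirectSum.
Variables (G : choiceType) (V : zmodType).
Implicit Types (S : set V) (A : G -> set V).

(* The finiteness clause is needed because a sum over an infinite support is
   0 by convention. *)
Definition decomposes A (x : V) (f : G -> V) : Prop :=
  [/\ forall g, A g (f g), finite_set [set g | f g != 0]
    & x = \sum_(g \in [set: G]) f g].

Definition internal_direct_sum S A : Prop :=
  (forall g, zmod_closed (mem (A g)) /\ A g `<=` S) /\
  (forall x, S x -> exists! f, decomposes A x f).

End DirectSum.

(* The zero ring is allowed. *)
Record gradedRing (G : groupType) := GradedRing {
  gr_ring :> comPzRingType;
  gr_comp : G -> set gr_ring;
  gr_sum : internal_direct_sum setT gr_comp;
  gr_mul : forall g h r s,
    gr_comp g r -> gr_comp h s -> gr_comp (g * h)%g (r * s)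
}.

Record gradedModule (G : groupType) (R : gradedRing G) := GradedModule {
  gm_mod :> lmodType R;
  gm_comp : G -> set gm_mod;
  gm_sum : internal_direct_sum setT gm_comp;
  gm_scale : forall g h (r : R) (m : gm_mod),
    gr_comp g r -> gm_comp h m -> gm_comp (g * h)%g (r *: m)
}.

Section GradedSubmodules.
Variables (G : groupType) (R : gradedRing G) (M : gradedModule R).
Implicit Types (N P Q : set M) (I : set R).

Definition ring_homogeneous : set R := \bigcup_g gr_comp g.
Definition mod_homogeneous : set M := \bigcup_g @gm_comp G R M g.

Definition graded_submodule N : Prop :=
  submod_closed (mem N) /\
  internal_direct_sum N (fun g => N `&` @gm_comp G R M g).

Definition colon N : set R := [set r | forall m : M, N (r *: m)].

(* The decomposition [f] of [a] is unique, so [exists] may be read "the". *)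
Definition graded_radical I : set R :=
  [set a | exists2 f, decomposes (@gr_comp G R) a f &
    forall g, exists2 n, (0 < n)%N & I (f g ^+ n)].

Definition graded_prime P : Prop :=
  [/\ graded_submodule P, P <> setT &
    forall r m, ring_homogeneous r -> mod_homogeneous m ->
      P (r *: m) -> P m \/ colon P r].

Definition graded_primary Q : Prop :=
  [/\ graded_submodule Q, Q <> setT &
    forall r m, ring_homogeneous r -> mod_homogeneous m ->
      Q (r *: m) -> Q m \/ graded_radical (colon Q) r].

(* This is [setT] when no graded prime submodule contains [N]. *)
Definition mod_radical N : set M :=
  \bigcap_(P in [set P | graded_prime P /\ N `<=` P]) P.

Definition primary_spec_mem Q : Prop :=
  graded_primary Q /\ colon (mod_radical Q) = graded_radical (colon Q).

End GradedSubmodules.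

Definition graded_spec (G : groupType) (R : gradedRing G) (M : gradedModule R)
  : set (set M) := [set P | graded_prime P].
Arguments graded_spec {G R} M.

Record primary_spec (G : groupType) (R : gradedRing G) (M : gradedModule R) :=
  PrimarySpec {
    primary_spec_val :> set M;
    primary_spec_valP : primary_spec_mem primary_spec_val
  }.

Definition nu (G : groupType) (R : gradedRing G) (M : gradedModule R)
    (N : set M) : set (primary_spec M) :=
  [set Q : primary_spec M | colon N `<=` colon (mod_radical Q)].

(* Facts needed to show that the sets [nu N] are the closed sets of a
   topology. *)

Section DirectSumFacts.
Variables (G : choiceType) (V : zmodType).
Implicit Types (S : set V) (A : G -> set V).

Lemma decomposesP A (x : V) (f : G -> V) :
  decomposes A x f <-> exists s : seq G,
    [/\ uniq s, forall g, A g (f g), forall g, g \notin s -> f g = 0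
      & x = \sum_(g <- s) f g].
Proof.
split=> [[Af fin ->]|[s [us Af f0 ->]]].
  exists (finite_support 0 setT f); split=> // g.
  rewrite in_finite_support ?setTI; last first.
    by apply: sub_finite_set fin => g' /= /eqP.
  by rewrite notin_setE /= => /contrapT.
split=> //; last first.
  rewrite (fsbigE s)//; first by apply: eq_bigl => g; rewrite in_setT.
  by move=> g _; exact: f0.
apply: (@sub_finite_set _ _ [set` s]) (finite_seq s) => g /=.
by apply: contraNT => /f0 ->.
Qed.

Lemma closed0 S : zmod_closed (mem S) -> S 0.
Proof. by case=> + _ => /set_mem. Qed.

Lemma decomposes_single A (g : G) (x : V) :
  (forall h, zmod_closed (mem (A h))) -> A g x ->
  decomposes A x (fun h => if h == g then x else 0).
Proof.
move=> A0 Ax; apply/decomposesP; exists [:: g]; split=> //.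
- by move=> h; case: eqP => [->//|_]; exact: closed0.
- by move=> h; rewrite inE => /negbTE ->.
- by rewrite big_seq1 eqxx.
Qed.

Lemma decomposes_uniq S A (x : V) (f f' : G -> V) :
  internal_direct_sum S A -> S x ->
  decomposes A x f -> decomposes A x f' -> f = f'.
Proof.
by move=> [_ /[apply]] [h [_ hu]] /hu <- /hu <-.
Qed.

End DirectSumFacts.

Section GradedFacts.
Variables (G : groupType) (R : gradedRing G) (M : gradedModule R).
Implicit Types (N P Q : set M).

Let Rg := @gr_comp G R.
Let Mg := @gm_comp G R M.

Lemma submod_clP N : submod_closed (mem N) <->
  [/\ N 0, forall x y, N x -> N y -> N (x + y)
    & forall (a : R) x, N x -> N (a *: x)].
Proof.
split=> [[/set_mem N0 NL]|[N0 ND NZ]].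
  split=> // [x y Nx Ny|a x Nx].
    by rewrite -[x]scale1r; apply/set_mem/NL; apply/mem_set.
  by rewrite -[_ *: _]addr0; apply/set_mem/NL; apply/mem_set.
split; first exact/mem_set.
move=> a x y /set_mem Nx /set_mem Ny; apply/mem_set/ND => //; exact: NZ.
Qed.

Lemma submod_sum N (s : seq G) (f : G -> M) : submod_closed (mem N) ->
  (forall g, N (f g)) -> N (\sum_(g <- s) f g).
Proof. by move=> /submod_clP[N0 ND _] Nf; elim/big_ind: _. Qed.

Lemma mod_dec (x : M) : exists f, decomposes Mg x f.
Proof. by have [f []] := (gm_sum M).2 x I; exists f. Qed.

Lemma ring_dec (x : R) : exists f, decomposes Rg x f.
Proof. by have [f []] := (gr_sum R).2 x I; exists f. Qed.

Lemma graded_submoduleP N : graded_submodule N <->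
  submod_closed (mem N) /\
  forall x f, N x -> decomposes Mg x f -> forall g, N (f g).
Proof.
split=> -[subN].
  move=> [_ dN]; split=> // x f Nx df g.
  have [f' [[Nf' fin xE] _]] := dN x Nx.
  suff -> : f = f' by have [] := Nf' g.
  apply: (decomposes_uniq (gm_sum M)) df _ => //.
  by split=> // h; have [] := Nf' h.
have [N0 ND NZ] := (submod_clP N).1 subN.
move=> dN; split=> //; split=> [g|x Nx].
  split; last by move=> x [].
  have [[/set_mem M0 MB] _] := (gm_sum M).1 g.
  split; first exact/mem_set.
  move=> x y /set_mem[Nx Mx] /set_mem[Ny My]; apply/mem_set; split.
    by apply: ND => //; rewrite -scaleN1r; exact: NZ.
  by apply/set_mem/MB; exact/mem_set.
have [f df] := mod_dec x; exists f; split.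
  case: (df) => Mf fin xE; split=> // g.
  by split; [exact: (dN x f Nx df g)|exact: Mf].
move=> f' [Nf' fin xE]; apply: (decomposes_uniq (gm_sum M)) df _ => //.
by split=> // g; have [] := Nf' g.
Qed.

Lemma graded_submodule_bigcap (F : set (set M)) :
  (forall N, F N -> graded_submodule N) ->
  graded_submodule (\bigcap_(N in F) N).
Proof.
move=> gF; apply/graded_submoduleP; split.
  apply/submod_clP; split.
  - by move=> N /gF[/submod_clP[]].
  - move=> x y Nx Ny N FN; have [/submod_clP[_ + _] _] := gF N FN.
    by apply; [exact: Nx|exact: Ny].
  - move=> a x Nx N FN; have [/submod_clP[_ _ +] _] := gF N FN.
    by apply; exact: Nx.
move=> x f Nx df g N FN.
by have /graded_submoduleP[_] := gF N FN; apply; [exact: Nx|exact: df].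
Qed.

Lemma graded_submodule_setT : graded_submodule [set: M].
Proof. by apply/graded_submoduleP; split=> //; apply/submod_clP. Qed.

Lemma graded_submoduleI N N' : graded_submodule N -> graded_submodule N' ->
  graded_submodule (N `&` N').
Proof.
move=> gN gN'; have -> : N `&` N' = \bigcap_(K in [set N; N']) K.
  by rewrite bigcap_setU !bigcap_set1.
by apply: graded_submodule_bigcap => _ [] ->.
Qed.

Lemma mod_radical_graded N : graded_submodule (mod_radical N).
Proof. by apply: graded_submodule_bigcap => P [[]]. Qed.

Lemma colon_component N (r : R) (f : G -> R) : graded_submodule N ->
  colon N r -> decomposes Rg r f -> forall g, colon N (f g).
Proof.
move=> gN Nr /decomposesP[s [us Rf f0 rE]] g m.
have [subN _] := gN.
have hom h y : Mg h y -> N (f g *: y).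
  move=> My; have /graded_submoduleP[_ gNy] := gN.
  rewrite -(mulgK h g).
  apply: (gNy (r *: y) (fun k => f (k * h^-1)%g *: y)) => //.
  apply/decomposesP; exists [seq (k * h)%g | k <- s]; split.
  - by rewrite map_inj_uniq//; exact: mulIg.
  - by move=> k; have := gm_scale (Rf (k * h^-1)%g) My; rewrite mulgVK.
  - move=> k ks; rewrite f0 ?scale0r//; apply: contra ks => ks.
    by apply/mapP; exists (k * h^-1)%g => //; rewrite mulgVK.
  - rewrite rE scaler_suml big_map; apply: eq_bigr => k _.
    by rewrite mulgK.
have [w /decomposesP[t [_ Mw _ ->]]] := mod_dec m.
rewrite scaler_sumr; apply: submod_sum => // k; exact: (hom k).
Qed.

Lemma graded_radical_homogeneous N (r : R) : submod_closed (mem N) ->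
  ring_homogeneous r ->
  graded_radical (colon N) r <-> exists2 n, (0 < n)%N & colon N (r ^+ n).
Proof.
move=> /submod_clP[N0 _ _] [g _ Rr].
have dr := decomposes_single (fun h => ((gr_sum R).1 h).1) Rr.
split=> [[f df /(_ g)]|[n n0 Nn]].
  by rewrite (decomposes_uniq (gr_sum R) I df dr) eqxx.
exists (fun h => if h == g then r else 0) => // h.
case: eqP => _; first by exists n.
by exists 1%N => // m; rewrite expr1 scale0r.
Qed.

Lemma ring_homogeneousX (r : R) n : (0 < n)%N ->
  ring_homogeneous r -> ring_homogeneous (r ^+ n).
Proof.
case: n => // n _ [g _ Rr]; elim: n => [|n [h _ IH]].
  by rewrite expr1; exists g.
by exists (g * h)%g => //; rewrite exprS; exact: gr_mul.
Qed.

Lemma colon_sub_radical N : colon N `<=` colon (mod_radical N).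
Proof. by move=> r Nr m P [_]; apply. Qed.

(* Failure of [I <= Gr(J)] for a graded [I] is witnessed by a homogeneous
   element. *)
Lemma not_sub_radical N Q : graded_submodule N -> submod_closed (mem Q) ->
  ~ (colon N `<=` graded_radical (colon Q)) ->
  exists r, [/\ ring_homogeneous r, colon N r & ~ graded_radical (colon Q) r].
Proof.
move=> gN sQ /existsNP[r /not_implyP[Nr nQr]].
have [f df] := ring_dec r.
apply: contrapT => H; apply: nQr; exists f => // g.
have hf : ring_homogeneous (f g) by exists g => //; case: df => + _ _; exact.
apply/(graded_radical_homogeneous sQ hf); apply: contrapT => nQf.
by apply: H; exists (f g); split=> //; exact: (colon_component gN Nr df).
Qed.

Lemma radical_colon_setI N N' Q :
  graded_submodule N -> graded_submodule N' -> graded_primary Q ->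
  colon (N `&` N') `<=` graded_radical (colon Q) ->
  colon N `<=` graded_radical (colon Q) \/
  colon N' `<=` graded_radical (colon Q).
Proof.
move=> gN gN' [gQ _ prQ] NN'.
have sQ := gQ.1; have sN := gN.1; have sN' := gN'.1.
apply: contrapT => /not_orP[].
move=> /(not_sub_radical gN sQ)[r [hr Nr nQr]].
move=> /(not_sub_radical gN' sQ)[r' [hr' Nr' nQr']].
have hrr' : ring_homogeneous (r * r').
  by have [g _ Rr] := hr; have [h _ Rr'] := hr';
    exists (g * h)%g => //; exact: gr_mul.
have : graded_radical (colon Q) (r * r').
  apply: NN' => m; rewrite -scalerA; split; first exact: Nr.
  by rewrite scalerA mulrC -scalerA; exact: Nr'.
move=> /(graded_radical_homogeneous sQ hrr')[n n0 Qn].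
apply: nQr'; apply/(graded_radical_homogeneous sQ hr'); exists n => // m.
have [w /decomposesP[t [_ Mw _ ->]]] := mod_dec m.
rewrite scaler_sumr; apply: submod_sum => // k.
have hrn := ring_homogeneousX n0 hr.
have [g _ Rrn'] := ring_homogeneousX n0 hr'.
have hm : mod_homogeneous (r' ^+ n *: w k).
  by exists (g * k)%g => //; exact: (gm_scale Rrn' (Mw k)).
case: (prQ _ _ hrn hm) => //.
  by rewrite scalerA -exprMn; exact: Qn.
move=> /(graded_radical_homogeneous sQ hrn)[p p0 Qp].
exfalso; apply: nQr; apply/(graded_radical_homogeneous sQ hr).
by exists (n * p)%N; [rewrite muln_gt0 n0|rewrite exprM].
Qed.

Lemma root_colonD N (a b : R) n p : submod_closed (mem N) ->
  colon N (a ^+ n) -> colon N (b ^+ p) -> colon N ((a + b) ^+ (n + p)).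
Proof.
move=> /submod_clP[N0 ND NZ] Na Nb m; rewrite exprDn scaler_suml.
elim/big_ind: _ => // i _; rewrite -scalerMnl.
have: N ((a ^+ (n + p - i) * b ^+ i) *: m).
  have [ip|pi] := leqP i p.
    have -> : (n + p - i = (p - i) + n)%N by rewrite addnBAC// [(p + n)%N]addnC.
    by rewrite exprD mulrAC -scalerA; apply: NZ; exact: Na.
  rewrite -(subnK (ltnW pi)) [X in _ * X]exprD mulrA -scalerA.
  by apply: NZ; exact: Nb.
move=> Nx; elim: 'C(_, _) => [|k IH]; first by rewrite mulr0n.
by rewrite mulrS; exact: ND.
Qed.

Lemma nu_setT : nu [set: M] = set0.
Proof.
rewrite -subset0 => Q; have [[gQ QT _] QE] := primary_spec_valP Q.
rewrite /nu/= QE => TQ.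
have sQ := gQ.1.
have [f df fn] := TQ 1 (fun=> Logic.I).
suff [n Q1] : exists n, colon Q (1 ^+ n).
  by apply/QT/seteqP; split=> // m _; rewrite -[m]scale1r -(expr1n R n).
have /decomposesP[s [_ _ _ {1}->]] := df.
elim/big_ind: _ => [|a b [n Qa] [p Qb]|g _].
- exists 1%N => m; rewrite expr1 scale0r.
  by have [] := (submod_clP Q).1 sQ.
- by exists (n + p)%N; exact: root_colonD.
- by have [n _ Qn] := fn g; exists n.
Qed.

Lemma nu_setI N N' : graded_submodule N -> graded_submodule N' ->
  nu N `|` nu N' = nu (N `&` N').
Proof.
move=> gN gN'; apply/seteqP; split=> [Q [] NQ r Nr|Q].
- by apply: NQ => m; have [] := Nr m.
- by apply: NQ => m; have [] := Nr m.
- have [pQ QE] := primary_spec_valP Q.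
  by rewrite /nu /= QE; exact: radical_colon_setI.
Qed.

Lemma nu_bigcap (I : Type) (N : I -> set M) :
  exists2 L, graded_submodule L & \bigcap_i nu (N i) = nu L.
Proof.
pose F := [set K : set M | graded_submodule K /\
                          forall i, colon (N i) `<=` colon K].
exists (\bigcap_(K in F) K).
  by apply: graded_submodule_bigcap => K [].
apply/seteqP; split=> [Q NQ r Lr m|Q LQ i _ r Nr].
  by apply: Lr; split=> [|i]; [exact: mod_radical_graded|exact: NQ].
by apply: LQ => m K [_ /(_ i r)]; apply.
Qed.

End GradedFacts.

HB.instance Definition _ (G : groupType) (R : gradedRing G)
  (M : gradedModule R) := gen_eqMixin (primary_spec M).
HB.instance Definition _ (G : groupType) (R : gradedRing G)
  (M : gradedModule R) := gen_choiceMixin (primary_spec M).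

Section Zariski.
Variables (G : groupType) (R : gradedRing G) (M : gradedModule R).

Definition zariski_open : set_system (primary_spec M) :=
  [set U | exists2 N : set M, graded_submodule N & ~` U = nu N].

Lemma zariski_openT : zariski_open setT.
Proof.
by exists setT; [exact: graded_submodule_setT|rewrite nu_setT setCT].
Qed.

Lemma zariski_openI : setI_closed zariski_open.
Proof.
move=> U V [N gN UE] [N' gN' VE]; exists (N `&` N').
  exact: graded_submoduleI.
by rewrite setCI UE VE nu_setI.
Qed.

Lemma zariski_open_bigU (I : Type) (U : I -> set (primary_spec M)) :
  (forall i, zariski_open (U i)) -> zariski_open (\bigcup_i U i).
Proof.
move=> oU.
have /choice[N NE] : forall i, exists N, ~` U i = nu N.
  by move=> i; have [N _ NE] := oU i; exists N.
have [L gL LE] := nu_bigcap N; exists L => //.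
by rewrite setC_bigcup -LE; apply: eq_bigcapr => i _.
Qed.

HB.instance Definition _ := isOpenTopological.Build (primary_spec M)
  zariski_openT zariski_openI zariski_open_bigU.

Lemma zariski_closedE (C : set (primary_spec M)) :
  closed C <-> exists2 N : set M, graded_submodule N & C = nu N.
Proof.
rewrite -openC; split=> -[N gN NE]; exists N => //; first by rewrite -NE setCK.
by rewrite setCK.
Qed.

End Zariski.

Definition irreducible_space (T : topologicalType) : Prop :=
  forall U V : set T, open U -> open V -> U !=set0 -> V !=set0 ->
    U `&` V !=set0.

(* A set is coerced to the type of its elements, which carries the induced
   topology. *)
Definition irreducible (T : topologicalType) (A : set T) : Prop :=
  irreducible_space A.

(* Main.v *)
Require Import Defs.
From HB Require Import structures.
From mathcomp Require Import all_boot all_algebra.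
From mathcomp Require Import all_classical topology.

Import GRing.Theory.
Local Open Scope classical_set_scope.
Local Open Scope ring_scope.

(** [Q] is a generic point of [nu Q]: if [Q] lies in [nu N] and [Q'] in [nu Q],
    then [(N : M)] is contained in [Gr((Q : M))], hence in
    [Gr(Gr((Q' : M))) = Gr((Q' : M))], so that [Q'] lies in [nu N].  Thus every
    open set meeting [nu Q] contains [Q].  When [0] is in the primary spectrum,
    [nu 0] is the whole space. *)

Lemma generic_point_irreducible_space {T : topologicalType} (x : T) :
  (forall U : set T, open U -> U !=set0 -> U x) -> irreducible_space T.
Proof. by move=> xU U V oU oV U0 V0; exists x; split; exact: xU. Qed.

Lemma generic_point_irreducible {T : topologicalType} {A : set T} (x : T) :
  A x -> (forall U : set T, open U -> A `&` U !=set0 -> U x) -> irreducible A.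
Proof.
move=> Ax xU.
apply: (generic_point_irreducible_space (SigSub (mem_set Ax) : A)).
(* Open sets of the induced topology are the preimages of open sets [U] of [T], and a point of such
   a preimage is a point of [A] lying in [U]. *)
move=> _ [U oU <-] [[y Ay] Uy]; apply: xU => //.
by exists y; split; [exact: set_mem|].
Qed.

Section GenericPoint.
Context {G : groupType} {R : gradedRing G} {M : gradedModule R}.
Implicit Types N : set M.

(** Powers of a homogeneous component stay homogeneous, so membership in the radical again means
    that a single power lies in [colon N]; the two exponents multiply. *)
Lemma graded_radical_idem (I : set R) N : submod_closed (mem N) ->
  I `<=` graded_radical (colon N) ->
  graded_radical I `<=` graded_radical (colon N).
Proof.
move=> sN IN r [f df fI]; exists f => // g.
have hf : ring_homogeneous (f g) by exists g => //; case: df.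
have [n n0 /IN] := fI g.
move=> /(graded_radical_homogeneous sN (ring_homogeneousX n0 hf))[p p0 Np].
by exists (n * p)%N; [rewrite muln_gt0 n0|rewrite exprM].
Qed.

Lemma nu_refl (Q : primary_spec M) : nu Q Q.
Proof. exact: colon_sub_radical. Qed.

(** The condition defining the primary spectrum turns [colon (mod_radical _)] into
    [graded_radical (colon _)] at both [Q] and [Q'], where idempotence applies. *)
Lemma nu_trans {N} {Q Q' : primary_spec M} : nu N Q -> nu Q Q' -> nu N Q'.
Proof.
have [[[sQ' _] _ _] Q'E] := primary_spec_valP Q'.
have [_ QE] := primary_spec_valP Q.
rewrite /nu /= Q'E QE => NQ QQ' r /NQ; exact: graded_radical_idem.
Qed.

Lemma zariski_open_generic (Q : primary_spec M) (U : set (primary_spec M)) :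
  open U -> nu Q `&` U !=set0 -> U Q.
Proof.
move=> [N _ UE] [Q' [QQ' UQ']]; apply: contrapT => nUQ.
(* [nu N] is the complement of [U]: if it contained [Q], it would also contain [Q'], which lies in
   [U]. *)
have /nu_trans/(_ QQ') : nu N Q by rewrite -UE.
by rewrite -UE; apply.
Qed.

Lemma nu_closed (Q : primary_spec M) : closed (nu Q).
Proof.
by apply/zariski_closedE; exists Q => //; have [[]] := primary_spec_valP Q.
Qed.

Lemma nu_set0 : nu [set 0 : M] = setT.
Proof.
(* An [r] in [colon [set 0]] annihilates [M], and every submodule contains 0. *)
apply/seteqP; split=> // Q _ r r0 m; rewrite (r0 m).
by have [/submod_clP[]] := mod_radical_graded Q.
Qed.

End GenericPoint.

Theorem theorem4p2 (G : groupType) (R : gradedRing G) (M : gradedModule R)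
    (spec_nonempty : graded_spec M !=set0)
    (primary_spec_nonempty : [set: primary_spec M] !=set0) :
  (forall Q : primary_spec M, closed (nu Q) /\ irreducible (nu Q)) /\
  (primary_spec_mem [set 0 : M] -> irreducible_space (primary_spec M)).
Proof.
split=> [Q|Q0].
  split; first exact: nu_closed.
  apply: (generic_point_irreducible Q); first exact: nu_refl.
  exact: zariski_open_generic.
apply: (generic_point_irreducible_space (PrimarySpec Q0)) => U oU U0.
by apply: zariski_open_generic => //; rewrite nu_set0 setTI.
Qed.
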